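(* Let $\mathcal{T}$ be an edge-to-edge spherical tiling by $F\ge 6$ congruent (possibly concave) quadrangles of type $t$, where $t\in\{2,4\}$, such that the map of $\mathcal{T}$ is the pseudo-double wheel $\mathrm{pdw}_F$ and every edge of length $b$ is non-meridian. Then the chart of $\mathcal{T}$, modulo mirror image, is necessarily $\mathcal{P}_F$.
   Context: Tilings are edge-to-edge tilings of the unit sphere, identified modulo $SO(3)$. Angles are measured in units of $\pi$ radians. Tile types. A spherical quadrangle has vertices with inner angles $\alpha,\beta,\gamma,\delta$ in this cyclic order. It is of type 4 if the edge joining the $\alpha$- and $\delta$-vertices has length $b$, the edge joining the $\delta$- and $\gamma$-vertices has length $c$, and the edges joining $\gamma,\beta$ and $\beta,\alpha$ both have length $a$, where $a,b,c$ are pairwise distinct. It is of type 2 if the same holds with $c=a\ne b$. For a type-2 quadrangle the labelings $(\alpha,\beta,\gamma,\delta)$ and $(\delta,\gamma,\beta,\alpha)$ describe the same tile; charts of type 2 are understood up to applying this relabeling simultaneously to all faces. Pseudo-double wheel. For even $F\ge6$, $\mathrm{pdw}_F$ is the spherical quadrangulation obtained from a cycle $v_0,\dots,v_{F-1}$ (indices mod $F$) by adding a vertex $N$ adjacent to every $v_{2i}$ and a vertex $S$ adjacent to every $v_{2i+1}$; its faces are $N v_{2i}v_{2i+1}v_{2i+2}$ and $S v_{2i-1}v_{2i}v_{2i+1}$, with the cyclic orders of this embedding. Edges incident to $N$ or $S$ are meridian, the others non-meridian. Charts. A chart consists of the map (graph with cyclic orders at vertices), an edge-length assignment, and an assignment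 of tile angles $\alpha,\beta,\gamma,\delta$ to the angles at vertices. The mirror image of a chart reverses all cyclic orders, keeping lengths, with angle $\angle uvw$ receiving the type of $\angle wvu$. The chart of $\mathcal{T}$ is $\mathcal{P}_F$ if the graph of $\mathcal{T}$ can be identified with $\mathrm{pdw}_F$ (preserving cyclic orders) so that lengths and angles agree with $\mathcal{P}_F$. The chart $\mathcal{P}_F$: map $\mathrm{pdw}_F$; each edge $v_{2i}v_{2i+1}$ has length $b$, each edge $v_{2i+1}v_{2i+2}$ has length $c$ (i.e. $a$ for type 2), each meridian edge has length $a$; in each face $N v_{2i}v_{2i+1}v_{2i+2}$ the angles at $N,v_{2i},v_{2i+1},v_{2i+2}$ are $\beta,\alpha,\delta,\gamma$, and in each face $S v_{2i-1}v_{2i}v_{2i+1}$ the angles at $S,v_{2i-1},v_{2i},v_{2i+1}$ are $\beta,\gamma,\delta,\alpha$. *)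

(* Defs.v *)
From HB Require Import structures.
From mathcomp Require Import all_boot all_order all_algebra.
From mathcomp Require Import all_classical all_reals all_analysis.

Set Implicit Arguments.
Unset Strict Implicit.
Unset Printing Implicit Defensive.

Import Order.TTheory GRing.Theory Num.Theory.
Local Open Scope ring_scope.

Section Vec.
Variable R : realType.
Definition vec3 := (R * R * R)%type.
Definition vdot (u v : vec3) : R :=
  u.1.1 * v.1.1 + u.1.2 * v.1.2 + u.2 * v.2.
Definition vcross (u v : vec3) : vec3 :=
  (u.1.2 * v.2 - u.2 * v.1.2, u.2 * v.1.1 - u.1.1 * v.2,
   u.1.1 * v.1.2 - u.1.2 * v.1.1).
Definition vadd (u v : vec3) : vec3 := (u.1.1 + v.1.1, u.1.2 + v.1.2, u.2 + v.2).
Definition vscale (s : R) (u : vec3) : vec3 := (s * u.1.1, s * u.1.2, s * u.2).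

(* Counterclockwise angle (in radians, in [0, 2 pi)) from the unit tangent   *)
(* vector [t1] to the unit tangent vector [t2] at the point [p] of the unit  *)
(* sphere, the sphere being oriented by its outward normal [p].             *)
Definition ccw_angle (p t1 t2 : vec3) : R :=
  if 0 <= vdot p (vcross t1 t2) then acos (vdot t1 t2)
  else 2 * pi - acos (vdot t1 t2).
End Vec.

(* The pseudo-double wheel pdw_F.                                           *)
(*  vertices : inl i = v_i (i : 'I_F), inr true = N, inr false = S.         *)
(*  faces    : indexed by their "centre" c : 'I_F;                           *)
(*    c odd  : the face N v_(c-1) v_c v_(c+1)   (c-1 even)                  *)
(*    c even : the face S v_(c-1) v_c v_(c+1)   (c-1 odd)                   *)
(*  corners of a face are listed in a fixed coherent (positive) orientation *)
(*  of the map:  c odd : (N, v_(c-1), v_c, v_(c+1)),                        *)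
(*               c even: (S, v_(c+1), v_c, v_(c-1)).                        *)
(*  edges    : inl i = the non-meridian edge v_i v_(i+1) (from v_i),        *)
(*             inr i = the meridian edge from v_i to N (i even) / S (i odd).*)
Section PDW.
Variable F : nat.

Definition pdw_vertex := ('I_F + bool)%type.
Definition pdw_edge := ('I_F + 'I_F)%type.

Definition vN : pdw_vertex := inr true.
Definition vS : pdw_vertex := inr false.
Definition vv (i : 'I_F) : pdw_vertex := inl i.

Definition pole_of (i : 'I_F) : pdw_vertex := if odd i then vS else vN.
Definition face_pole (c : 'I_F) : pdw_vertex := if odd c then vN else vS.

Definition face_n1 (c : 'I_F) : 'I_F := if odd c then ord_pred c else ordS c.
Definition face_n3 (c : 'I_F) : 'I_F := if odd c then ordS c else ord_pred c.

Definition corner (c : 'I_F) (k : 'I_4) : pdw_vertex :=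
  match val k with
  | 0 => face_pole c
  | 1 => vv (face_n1 c)
  | 2 => vv c
  | _ => vv (face_n3 c)
  end.

(* side k of face c : the edge joining corner k and corner k+1 *)
Definition side (c : 'I_F) (k : 'I_4) : pdw_edge :=
  match val k with
  | 0 => inr (face_n1 c)
  | 1 => inl (if odd c then ord_pred c else c)
  | 2 => inl (if odd c then c else ord_pred c)
  | _ => inr (face_n3 c)
  end.

Definition esrc (e : pdw_edge) : pdw_vertex :=
  match e with inl i => vv i | inr i => vv i end.
Definition edst (e : pdw_edge) : pdw_vertex :=
  match e with inl i => vv (ordS i) | inr i => pole_of i end.

Definition incident (x : pdw_vertex) (e : pdw_edge) : bool :=
  (x == esrc e) || (x == edst e).

Definition corner_triple (c : 'I_F) (k : 'I_4) :=
  (corner c (k - 1)%R, corner c k, corner c (k + 1)%R).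
End PDW.

(* A geometric realisation of pdw_F on the unit sphere: an edge-to-edge     *)
(* spherical tiling whose map (graph with cyclic orders) is pdw_F.          *)
(* Each edge e is a great arc  s |-> cos s * P + sin s * T,  s in [0,len e] *)
(* where P = pos (esrc e), T = etan e is a unit tangent vector at P and     *)
(* 0 < len e < 2 pi.                                                         *)
Record sph_drawing (R : realType) (F : nat) := SphDrawing {
  pos  : pdw_vertex F -> vec3 R;
  etan : pdw_edge F -> vec3 R;
  elen : pdw_edge F -> R
}.

Section Geometry.
Variables (R : realType) (F : nat) (D : sph_drawing R F).

Definition arc (e : pdw_edge F) (s : R) : vec3 R :=
  vadd (vscale (cos s) (pos D (esrc e))) (vscale (sin s) (etan D e)).

(* unit tangent vector at the vertex x of the edge e, pointing along e *)
Definition dart_tan (e : pdw_edge F) (x : pdw_vertex F) : vec3 R :=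
  if x == esrc e then etan D e
  else (* at the other endpoint: minus the velocity of the arc at len e *)
    vadd (vscale (sin (elen D e)) (pos D (esrc e)))
         (vscale (- cos (elen D e)) (etan D e)).

(* inner angle (radians) of the tile c at its corner k: the counterclockwise *)
(* angle at corner k from the side towards corner k+1 to the side towards    *)
(* corner k-1 (the tile lies to the left of its positively oriented boundary)*)
Definition inner_angle (c : 'I_F) (k : 'I_4) : R :=
  ccw_angle (pos D (corner c k)) (dart_tan (side c k) (corner c k))
            (dart_tan (side c (k - 1)%R) (corner c k)).

Definition is_pdw_tiling : Prop :=
  [/\ (forall x, vdot (pos D x) (pos D x) = 1),
      injective (pos D),
      (forall e, [/\ vdot (etan D e) (etan D e) = 1,
                     vdot (etan D e) (pos D (esrc e)) = 0,
                     0 < elen D e < 2 * pi &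
                     arc e (elen D e) = pos D (edst e)]),
      (forall e e' s s', e != e' -> 0 <= s <= elen D e -> 0 <= s' <= elen D e' ->
         arc e s = arc e' s' ->
         exists2 x, incident x e && incident x e' & pos D x = arc e s) &
  (* the cyclic order of the edges around every vertex is the one of pdw_F  *)
  (* (for the orientation given by the outward normal): the angles of the    *)
  (* corners at each vertex, taken in the rotation of pdw_F, add up to 2 pi  *)
      (forall x, \sum_(ck : 'I_F * 'I_4 | corner ck.1 ck.2 == x)
                    inner_angle ck.1 ck.2 = 2 * pi)].
End Geometry.

(* Angle names: 0 = alpha, 1 = beta, 2 = gamma, 3 = delta (cyclic order).    *)
(* The prototype edges: alpha-beta : a, beta-gamma : a, gamma-delta : c,     *)
(* delta-alpha : b.                                                          *)
Definition proto_len (R : Type) (a b c : R) (X Y : 'I_4) : R :=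
  let m := if Y == (X + 1)%R then X else Y in
  match val m with 0 => a | 1 => a | 2 => c | _ => b end.

Definition quad_type (R : realType) (t : nat) (a b c : R) : Prop :=
  if t == 4%N then [/\ a != b, b != c & a != c]
  else if t == 2%N then c = a /\ a != b else False.

(* A chart of the tiling D by congruent quadrangles of type t: a prototype   *)
(* quadrangle (edge lengths a, b, c; angles ang alpha .. ang delta) and, for *)
(* each tile, an identification of its corners with alpha, beta, gamma,     *)
(* delta preserving or reversing the cyclic order (i.e. a congruence,       *)
(* direct or indirect, with the prototype: two spherical polygons are       *)
(* congruent iff their sides and angles agree in dihedral correspondence),   *)
(* compatible with edge lengths and inner angles.                           *)
Definition is_chart (R : realType) (F : nat) (D : sph_drawing R F) (t : nat)
    (a b c : R) (ang : 'I_4 -> R) (lab : 'I_F -> 'I_4 -> 'I_4) : Prop :=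
  [/\ quad_type t a b c,
      (forall f, exists r : 'I_4,
          (forall k, lab f k = r + k)%R \/ (forall k, lab f k = r - k)%R),
      (forall f k, inner_angle D f k = ang (lab f k)) &
      (forall f k, elen D (side f k) = proto_len a b c (lab f k) (lab f (k + 1)%R))].

(* The chart P_F, in the positive orientation of pdw_F used above:           *)
(*  N face (c odd)  (N, v_(c-1), v_c, v_(c+1)) has angles (beta,alpha,delta,gamma)*)
(*  S face (c even) (S, v_(c+1), v_c, v_(c-1)) has angles (beta,alpha,delta,gamma)*)
(*   i.e. (S, v_(c-1), v_c, v_(c+1)) = (beta, gamma, delta, alpha).          *)
(*  edge v_(2i) v_(2i+1) : b,  edge v_(2i+1) v_(2i+2) : c,  meridians : a.   *)
Definition PF_angle (F : nat) (c : 'I_F) (k : 'I_4) : 'I_4 :=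
  match val k with 0 => 1 | 1 => 0 | 2 => 3 | _ => 2 end%R.

Definition PF_len (R : Type) (F : nat) (a b c : R) (e : pdw_edge F) : R :=
  match e with inl i => if odd i then c else b | inr _ => a end.

Definition relab2 (X : 'I_4) : 'I_4 := (3 - X)%R.

(* "the chart of D given by lab is, modulo mirror image, P_F": there is an   *)
(* identification sigma of the graph with pdw_F, either preserving all       *)
(* cyclic orders (mir = false) or reversing all of them (mir = true; this    *)
(* compares the mirror image of the chart with P_F), under which angles and  *)
(* edge lengths agree with P_F (for type 2 up to the simultaneous relabeling)*)
Definition chart_is_PF_mod_mirror (R : realType) (F : nat) (D : sph_drawing R F)
    (t : nat) (a b c : R) (lab : 'I_F -> 'I_4 -> 'I_4) : Prop :=
  exists (sigma : pdw_vertex F -> pdw_vertex F) (mir : bool) (rl : bool),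
    [/\ injective sigma, (rl -> t = 2%N) &
      forall f k, exists (f' : 'I_F) (k' : 'I_4),
        let: (u, x, w) := corner_triple f k in
        [/\ corner_triple f' k' =
              (if mir then (sigma w, sigma x, sigma u)
               else (sigma u, sigma x, sigma w)),
            (if rl then relab2 (lab f k) else lab f k) = PF_angle f' k' &
            elen D (side f k) =
              PF_len a b c (side f' (if mir then k' - 1 else k')%R)]].

(* Main.v *)
(** Every tile has exactly one [b]-edge, and it is not meridian, so the [b]-edges
    alternate around the cycle; a tile then only has one binary choice [s] left,
    namely whether its angle at the pole is beta or gamma, and the chart is P_F or
    its mirror image as soon as [s] is constant.
    For type 4 a tile with gamma at the pole has a meridian of length [c], which
    the neighbouring tile forces to have length [a].
    For type 2, if beta <> gamma the angle sums at the vertices force [s] to be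
    constant or to change across all [b]-edges. In the latter case [s] may also
    change across all the other non-meridian edges, and then the angle sums at the
    two poles give beta = gamma; or it never does. Equal angles at the ends of an
    [a]-edge of the cycle make it symmetric under a half-turn exchanging the poles;
    since distinct such edges have distinct midpoints, the poles are opposite and
    cos a + (1 - cos a) cos phi = 0. Hence cos beta = cos gamma, so beta + gamma is
    2 pi, whereas the angle sums give F (beta + gamma) = 8 pi.
    Finally beta = gamma = 4 pi / F is impossible: for F >= 8 a meridian crosses an
    edge of the cycle, and for F = 6 the vertices are those of a cube and the
    [b]-edge, being longer than pi, runs through a third vertex. *)
Require Import Defs.
From HB Require Import structures.
From mathcomp Require Import all_boot all_order all_algebra.
From mathcomp Require Import all_classical all_reals all_analysis.
From mathcomp Require Import zify ring lra.
Import Order.TTheory GRing.Theory Num.Theory.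
Local Open Scope ring_scope.

Set Implicit Arguments.
Unset Strict Implicit.
Unset Printing Implicit Defensive.

(** * Angles and rotations at a point of the sphere *)

Section Vectors.
Variable R : realType.
Implicit Types (p q u v w x y : vec3 R) (s : R).

Lemma vdotC u v : vdot u v = vdot v u.
Proof. by rewrite /vdot; ring. Qed.

Lemma vdotDl u v w : vdot (vadd u v) w = vdot u w + vdot v w.
Proof. by rewrite /vdot /=; ring. Qed.

Lemma vdotDr u v w : vdot w (vadd u v) = vdot w u + vdot w v.
Proof. by rewrite /vdot /=; ring. Qed.

Lemma vdotZl s u v : vdot (vscale s u) v = s * vdot u v.
Proof. by rewrite /vdot /=; ring. Qed.

Lemma vdotZr s u v : vdot u (vscale s v) = s * vdot u v.
Proof. by rewrite /vdot /=; ring. Qed.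

Lemma vec3P u v :
  u.1.1 = v.1.1 -> u.1.2 = v.1.2 -> u.2 = v.2 -> u = v.
Proof. by case: u v => [[u1 u2] u3] [[v1 v2] v3] /= -> -> ->. Qed.

Lemma vdot_ge0 u : 0 <= vdot u u.
Proof. by rewrite /vdot -!expr2; rewrite !addr_ge0 ?sqr_ge0. Qed.

Lemma vdot_eq0 u : vdot u u = 0 -> u = (0, 0, 0).
Proof.
rewrite /vdot -!expr2 => /eqP.
rewrite !paddr_eq0 ?addr_ge0 ?sqr_ge0 // !sqrf_eq0.
by move=> /andP[/andP[/eqP h1 /eqP h2] /eqP h3]; exact: vec3P.
Qed.

(* The Gram determinant of the three unit vectors. *)
Lemma triple_product_sq p u v : vdot p p = 1 -> vdot u u = 1 -> vdot v v = 1 ->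
  vdot u p = 0 -> vdot v p = 0 ->
  vdot p (vcross u v) ^+ 2 = 1 - vdot u v ^+ 2.
Proof.
move=> pp uu vv up vp.
have -> : vdot p (vcross u v) ^+ 2 =
  vdot p p * (vdot u u * vdot v v - vdot u v ^+ 2)
  - vdot u p * (vdot u p * vdot v v - vdot u v * vdot v p)
  + vdot v p * (vdot u p * vdot u v - vdot u u * vdot v p).
  by rewrite /vdot /vcross /=; ring.
by rewrite pp uu vv up vp; ring.
Qed.

Lemma cauchy_unit u v : vdot u u = 1 -> vdot v v = 1 -> -1 <= vdot u v <= 1.
Proof.
move=> uu vv.
have := vdot_ge0 (vadd u v); have := vdot_ge0 (vadd u (vscale (-1) v)).
rewrite !(vdotDl, vdotDr, vdotZl, vdotZr) uu vv (vdotC v u) => h1 h2.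
by apply/andP; split; lra.
Qed.

Lemma cos_ccw_angle p u v : vdot u u = 1 -> vdot v v = 1 ->
  cos (ccw_angle p u v) = vdot u v.
Proof.
move=> uu vv; have uv := cauchy_unit uu vv.
have h : cos (acos (vdot u v)) = vdot u v by rewrite acosK // in_itv.
rewrite /ccw_angle; case: ifP => // _.
have -> : 2 * pi - acos (vdot u v) = - acos (vdot u v) + pi *+ 2 by ring.
by rewrite cosD2pi cosN.
Qed.

Lemma ccw_angle_itv p u v : vdot u u = 1 -> vdot v v = 1 ->
  0 <= ccw_angle p u v <= 2 * pi.
Proof.
move=> uu vv; have uv := cauchy_unit uu vv.
have := acos_ge0 uv; have := acos_lepi uv; have := @pi_ge0 R.
by rewrite /ccw_angle; case: ifP => _ ? ? ?; apply/andP; split; lra.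
Qed.

Lemma sin_ccw_angle p u v : vdot p p = 1 -> vdot u u = 1 -> vdot v v = 1 ->
  vdot u p = 0 -> vdot v p = 0 ->
  sin (ccw_angle p u v) = vdot p (vcross u v).
Proof.
move=> pp uu vv up vp; have uv := cauchy_unit uu vv.
have h : sin (acos (vdot u v)) = `|vdot p (vcross u v)|.
  by rewrite sin_acos // -(triple_product_sq pp) // sqrtr_sqr.
rewrite /ccw_angle; case: ifPn => [p0|]; first by rewrite h ger0_norm.
rewrite -ltNge => p0.
have -> : 2 * pi - acos (vdot u v) = - acos (vdot u v) + pi *+ 2 by ring.
by rewrite sinD2pi sinN h ltr0_norm // opprK.
Qed.

(** In the tangent plane at [p], [u] and [vcross p u] form an orthonormal frame, and [v] has the
    cosine and the sine of the angle as coordinates. Nothing remains besides: the difference [w] has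
    squared norm zero. *)
Lemma ccw_angle_rotate p u v : vdot p p = 1 -> vdot u u = 1 -> vdot v v = 1 ->
  vdot u p = 0 -> vdot v p = 0 ->
  v = vadd (vscale (cos (ccw_angle p u v)) u)
           (vscale (sin (ccw_angle p u v)) (vcross p u)).
Proof.
move=> pp uu vv up vp.
rewrite cos_ccw_angle // sin_ccw_angle //.
set d := vdot u v; set s := vdot p (vcross u v).
have ds : s ^+ 2 = 1 - d ^+ 2 by exact: triple_product_sq.
have pu2 : vdot (vcross p u) (vcross p u) = 1.
  have -> : vdot (vcross p u) (vcross p u) = vdot p p * vdot u u - vdot u p ^+ 2.
    by rewrite /vdot /vcross /=; ring.
  by rewrite pp uu up; ring.
have pv : vdot v (vcross p u) = s by rewrite /s /vdot /vcross /=; ring.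
have pu : vdot u (vcross p u) = 0 by rewrite /vdot /vcross /=; ring.
set w := vadd v (vscale (-1) (vadd (vscale d u) (vscale s (vcross p u)))).
have : vdot w w = 0.
  rewrite /w !(vdotDl, vdotDr, vdotZl, vdotZr) (vdotC (vcross p u) v) (vdotC (vcross p u) u).
  rewrite (vdotC v u) -/d vv pv pu uu pu2.
  by ring: ds.
move=> /vdot_eq0; rewrite /w => /pair_equal_spec[/pair_equal_spec[h1 h2] h3].
by apply: vec3P; move: h1 h2 h3 => /=; lra.
Qed.

(* [C] is the cosine of the common length of the two sides at the corner [x],
   so that [x] times the endpoint of a side is the sine times the tangent. *)
Definition swing (C phi : R) x y : vec3 R :=
  vadd (vscale C x)
    (vadd (vscale (cos phi) (vadd y (vscale (- C) x)))
          (vscale (sin phi) (vcross x y))).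

(** Both sides have length [L], so turning about [x] by the inner angle carries the end of one to
    the end of the other, and the opposite turn carries it back. *)
Lemma swing_arcs x u v (L : R) : vdot x x = 1 -> vdot u u = 1 -> vdot v v = 1 ->
  vdot u x = 0 -> vdot v x = 0 ->
  let y := vadd (vscale (cos L) x) (vscale (sin L) u) in
  let z := vadd (vscale (cos L) x) (vscale (sin L) v) in
  z = swing (cos L) (ccw_angle x u v) x y /\
  y = swing (cos L) (- ccw_angle x u v) x z.
Proof.
move=> xx uu vv ux vx y z.
set phi := ccw_angle x u v.
have hv : v = vadd (vscale (cos phi) u) (vscale (sin phi) (vcross x u)).
  exact: ccw_angle_rotate.
have hz : z = swing (cos L) phi x y.
  by rewrite /z hv /swing /y; apply: vec3P => /=; ring.
split=> //.
have hu : u = vadd (vscale (cos phi) v) (vscale (- sin phi) (vcross x v)).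
  have xxu : vcross x (vcross x u) = vscale (-1) u.
    have -> : vcross x (vcross x u) =
        vadd (vscale (vdot u x) x) (vscale (- vdot x x) u).
      by rewrite /vdot; apply: vec3P => /=; ring.
    by rewrite ux xx; apply: vec3P => /=; ring.
  have cs := cos2sin2 phi.
  have e : vcross x v = vadd (vscale (cos phi) (vcross x u)) (vscale (sin phi) (vscale (-1) u)).
    by rewrite -xxu hv; apply: vec3P => /=; ring.
  by rewrite e {1}hv; apply: vec3P => /=; ring: cs.
by rewrite /y {1}hu /swing /z cosN sinN; apply: vec3P => /=; ring.
Qed.

End Vectors.

(** * Sides and corners of the tiles *)

Section Combinatorics.
Variable F : nat.
Hypothesis Feven : ~~ odd F.
Implicit Types (f i : 'I_F) (k : 'I_4) (e : pdw_edge F) (u w x : pdw_vertex F).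

Lemma odd_modn_even m : odd (m %% F)%N = odd m.
Proof. by rewrite [in RHS](divn_eq m F) oddD oddM (negbTE Feven) andbF. Qed.

Lemma odd_ordS i : odd (ordS i) = ~~ odd i.
Proof. by rewrite /= odd_modn_even. Qed.

Lemma odd_ord_pred i : odd (ord_pred i) = ~~ odd i.
Proof. by rewrite -{2}(ord_predK i) odd_ordS negbK. Qed.

(** Edges have a fixed direction while the sides of a tile run around it, so endpoints are compared
    up to order. *)
Definition joins e u w :=
  (esrc e = u /\ edst e = w) \/ (esrc e = w /\ edst e = u).

Lemma joinsC e u w : joins e u w -> joins e w u.
Proof. by case; [right | left]. Qed.

Lemma esrc_neq_edst e : esrc e != edst e.
Proof.
case: e => i /=; last by rewrite /pole_of; case: ifP.
apply/eqP => /(congr1 (fun x : pdw_vertex F => if x is inl j then odd j else true)).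
by rewrite /= odd_modn_even /=; case: odd.
Qed.

Lemma side_joins f k : joins (side f k) (corner f k) (corner f (k + 1)).
Proof.
have oS := odd_ordS f; have oP := odd_ord_pred f.
case: k => [[|[|[|[|//]]]] lt_k4];
  rewrite /joins /side /corner /= /pole_of /face_pole /face_n1 /face_n3;
  case: ifP oS oP => o oS oP; rewrite ?oS ?oP ?ord_predK; tauto.
Qed.

Lemma side_joins_prev f k : joins (side f (k - 1)) (corner f k) (corner f (k - 1)).
Proof. by apply: joinsC; have := side_joins f (k - 1); rewrite subrK. Qed.

End Combinatorics.

(** * Edges as great arcs, and their crossings *)

Section Drawing.
Variables (R : realType) (F : nat) (D : sph_drawing R F).
Hypotheses (Feven : ~~ odd F) (tilD : is_pdw_tiling D).
Implicit Types (f i : 'I_F) (k : 'I_4) (e : pdw_edge F) (u w x : pdw_vertex F).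

(** A great arc run backwards is again a great arc, starting with minus its final velocity; hence
    one formula serves both ends. *)
Lemma dart_end e u w : joins e u w ->
  [/\ vdot (dart_tan D e u) (dart_tan D e u) = 1,
      vdot (dart_tan D e u) (pos D u) = 0 &
      pos D w = vadd (vscale (cos (elen D e)) (pos D u))
                     (vscale (sin (elen D e)) (dart_tan D e u))].
Proof.
case: tilD => unit _ edges _ _.
have [tt tp _ he] := edges e; have pp := unit (esrc e).
have cs := cos2sin2 (elen D e).
rewrite /dart_tan => -[] [<- <-]; first by rewrite eqxx.
rewrite eq_sym (negbTE (esrc_neq_edst Feven e)) -he /Defs.arc.
rewrite !(vdotDl, vdotDr, vdotZl, vdotZr) tt pp [vdot (pos D _) _]vdotC tp.
split; [by ring: cs | by ring |].
by apply: vec3P => /=; ring: cs.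
Qed.

Lemma corner_swing f k C : cos (elen D (side f k)) = C ->
  elen D (side f k) = elen D (side f (k - 1)) ->
  let x := pos D (corner f k) in
  let y := pos D (corner f (k + 1)) in
  let z := pos D (corner f (k - 1)) in
  let phi := inner_angle D f k in
  z = swing C phi x y /\ y = swing C (- phi) x z.
Proof.
move=> <- eqL x y z phi.
have [uu ux hy] := dart_end (side_joins Feven f k).
have [vv vx hz] := dart_end (side_joins_prev Feven f k).
case: tilD => unit _ _ _ _.
by rewrite /y /z hy hz -eqL; apply: swing_arcs.
Qed.

Lemma inner_angle_itv f k : 0 <= inner_angle D f k <= 2 * pi.
Proof.
have [uu _ _] := dart_end (side_joins Feven f k).
have [vv _ _] := dart_end (side_joins_prev Feven f k).
exact: ccw_angle_itv.
Qed.

(** An arc shorter than a half-circle spans the cone of its two endpoints. This turns crossings of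
    edges into linear identities between vertices. *)
Lemma arc_combination_src e (x y : R) : elen D e < pi -> 0 <= x -> 0 <= y ->
  0 < x + y ->
  let v := vadd (vscale x (pos D (esrc e))) (vscale y (pos D (edst e))) in
  0 < vdot v v /\
  exists2 s, 0 <= s <= elen D e & v = vscale (Num.sqrt (vdot v v)) (Defs.arc D e s).
Proof.
case: tilD => unit _ edges _ _; have [tt tp /andP[L0 _] he] := edges e.
move=> Lpi x0 y0 xy0 v.
set L := elen D e in L0 Lpi he *.
have S0 : 0 < sin L by rewrite sin_gt0_pi // L0.
set p := x + y * cos L; set q := y * sin L.
have vE : v = vadd (vscale p (pos D (esrc e))) (vscale q (etan D e)).
  by rewrite /v -he /p /q /Defs.arc; apply: vec3P => /=; ring.
have vvE : vdot v v = p ^+ 2 + q ^+ 2.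
  rewrite vE !(vdotDl, vdotDr, vdotZl, vdotZr) tt unit [vdot (pos D _) _]vdotC tp; ring.
have vv0 : 0 < vdot v v.
  rewrite vvE lt_def addr_ge0 ?sqr_ge0 // andbT paddr_eq0 ?sqr_ge0 //.
  rewrite !sqrf_eq0 negb_and mulf_eq0 (gt_eqF S0) orbF.
  have [y00|] := eqVneq y 0; last by rewrite orbT.
  by rewrite /p y00 mul0r addr0 orbF gt_eqF //; move: xy0; rewrite y00 addr0.
split=> //.
set t := Num.sqrt (vdot v v).
have t0 : 0 < t by rewrite sqrtr_gt0.
have tt2 : t ^+ 2 = p ^+ 2 + q ^+ 2 by rewrite -vvE sqr_sqrtr // ltW.
have q0 : 0 <= q by rewrite mulr_ge0 // ltW.
have pq1 : (p / t) ^+ 2 + (q / t) ^+ 2 = 1.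
  by rewrite !expr_div_n -mulrDl -tt2 divff // expf_neq0 // gt_eqF.
have pt : -1 <= p / t <= 1.
  rewrite -ler_norml -(@ler_pXn2r _ 2) ?nnegrE // expr1n -[leLHS]normrX.
  by rewrite ger0_norm ?sqr_ge0 // -pq1 lerDl sqr_ge0.
(* The parameter is the polar angle of [(p, q)]. If it exceeded [L], the excess would have a
   positive sine, but that sine is minus [sin L * x / t]. *)
exists (acos (p / t)).
  rewrite acos_ge0 //= leNgt; apply/negP => lt_L.
  have : 0 < sin (acos (p / t) - L).
    apply: sin_gt0_pi; rewrite subr_gt0 lt_L /= ltrBlDr.
    by apply: (le_lt_trans (acos_lepi pt)); rewrite ltrDl.
  rewrite sinB acosK ?in_itv // sin_acos //.
  have -> : Num.sqrt (1 - (p / t) ^+ 2) = q / t.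
    by rewrite -pq1 addrC addKr sqrtr_sqr ger0_norm // divr_ge0 // ltW.
  have -> : q / t * cos L - p / t * sin L = - (sin L * x / t).
    by rewrite /q /p; field; rewrite gt_eqF.
  by rewrite oppr_gt0 ltNge divr_ge0 ?mulr_ge0 // ltW.
rewrite /Defs.arc acosK ?in_itv // sin_acos //.
have -> : Num.sqrt (1 - (p / t) ^+ 2) = q / t.
  by rewrite -pq1 addrC addKr sqrtr_sqr ger0_norm // divr_ge0 // ltW.
by rewrite {1}vE; apply: vec3P => /=; field; rewrite gt_eqF.
Qed.

Lemma arc_combination e u w (x y : R) : joins e u w -> elen D e < pi ->
  0 <= x -> 0 <= y -> 0 < x + y ->
  let v := vadd (vscale x (pos D u)) (vscale y (pos D w)) in
  0 < vdot v v /\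
  exists2 s, 0 <= s <= elen D e & v = vscale (Num.sqrt (vdot v v)) (Defs.arc D e s).
Proof.
move=> + Lpi x0 y0 xy0; case=> -[<- <-] /=; first exact: arc_combination_src.
have -> : vadd (vscale x (pos D (edst e))) (vscale y (pos D (esrc e))) =
  vadd (vscale y (pos D (esrc e))) (vscale x (pos D (edst e))).
  by apply: vec3P => /=; rewrite addrC.
by apply: arc_combination_src => //; rewrite addrC.
Qed.

Lemma incident_joins e u w x : joins e u w -> incident x e -> x = u \/ x = w.
Proof. by rewrite /incident; case=> -[-> ->] /orP[] /eqP ->; [left|right|right|left]. Qed.

Lemma joins_incident e u w : joins e u w -> incident u e.
Proof. by rewrite /incident; case=> -[-> ->]; rewrite eqxx ?orbT. Qed.

(** Normalising a common vector of the two cones gives a common point of the two arcs, and a tiling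
    allows this only at a common endpoint. *)
Lemma edges_disjoint e e' u w u' w' (x y x' y' : R) :
  joins e u w -> joins e' u' w' -> elen D e < pi -> elen D e' < pi ->
  u != u' -> u != w' -> w != u' -> w != w' ->
  0 <= x -> 0 <= y -> 0 < x + y -> 0 <= x' -> 0 <= y' -> 0 < x' + y' ->
  vadd (vscale x (pos D u)) (vscale y (pos D w)) <>
  vadd (vscale x' (pos D u')) (vscale y' (pos D w')).
Proof.
move=> j j' L L' /eqP uu' /eqP uw' /eqP wu' /eqP ww' x0 y0 xy0 x0' y0' xy0' eqv.
have /= [v0 [s sL vs]] := arc_combination j L x0 y0 xy0.
have /= [_ [s' sL' vs']] := arc_combination j' L' x0' y0' xy0'.
have eq_arc : Defs.arc D e s = Defs.arc D e' s'.
  rewrite -eqv in vs'.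
  have t0 : Num.sqrt (vdot (vadd (vscale x (pos D u)) (vscale y (pos D w)))
                      (vadd (vscale x (pos D u)) (vscale y (pos D w)))) != 0.
    by rewrite gt_eqF // sqrtr_gt0.
  move: t0 vs vs'; set t := Num.sqrt _ => t0 -> /pair_equal_spec[/pair_equal_spec[h1 h2] h3].
  by apply: vec3P; apply: (mulfI t0).
have ee' : e != e'.
  apply/eqP => ee'; have := joins_incident j; rewrite ee' => /(incident_joins j').
  by case.
case: tilD => _ _ _ cross _.
have [z /andP[/(incident_joins j) hz /(incident_joins j') hz'] _] :=
  cross _ _ _ _ ee' sL sL' eq_arc.
by case: hz hz' => -> [].
Qed.

(** The vertex starts its own meridian, so any other edge passing through it meets that meridian
    there and must end there. *)
Lemma vertex_on_edge i e s : 0 <= s <= elen D e -> Defs.arc D e s = pos D (vv i) ->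
  incident (vv i) e.
Proof.
case: tilD => _ inj edges cross _ hs hi.
have [->|ne] := eqVneq e (inr i); first by rewrite /incident eqxx.
have [_ _ /andP[/ltW L0 _] _] := edges (inr i).
have h0 : Defs.arc D e s = Defs.arc D (inr i) 0.
  by rewrite hi /Defs.arc cos0 sin0; apply: vec3P => /=; ring.
have zero_itv : (0 : R) <= 0 <= elen D (inr i) by apply/andP; split.
have [z /andP[ze _]] := cross _ _ _ _ ne hs zero_itv h0.
by rewrite hi => /inj <-.
Qed.

(* Two meridians that reach half a great circle would meet again opposite N. *)
Lemma meridian_lt_pi (a : R) : (2 < F)%N -> (forall i, elen D (inr i) = a) -> a < pi.
Proof.
move=> F2 ha; rewrite ltNge; apply/negP => pi_a.
case: tilD => unit _ edges cross _.
pose i0 := Ordinal (leq_trans (isT : 0 < 3)%N F2).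
pose i2 := Ordinal F2.
(* Going back by pi from the end N of a meridian leads to the antipode of N. *)
have opp i : ~~ odd i -> Defs.arc D (inr i) (a - pi) = vscale (-1) (pos D (vN F)).
  move=> oi; have [_ _ _] := edges (inr i).
  rewrite ha /= /pole_of (negbTE oi) => <-.
  rewrite /Defs.arc cosB sinB cospi sinpi; apply: vec3P => /=; ring.
have s_itv i : 0 <= a - pi <= elen D (inr i).
  by rewrite ha subr_ge0 pi_a lerBlDr lerDl pi_ge0.
have eq_arc : Defs.arc D (inr i0) (a - pi) = Defs.arc D (inr i2) (a - pi).
  by rewrite !opp.
have [x] := cross _ _ _ _ (isT : inr i0 != inr i2) (s_itv i0) (s_itv i2) eq_arc.
rewrite opp // => /andP[h0 h2] hx.
have {h0 h2} xN : x = vN F.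
  by case/orP: h0 => /eqP e0 //; move: h2; rewrite e0.
rewrite xN in hx; have := congr1 (vdot (pos D (vN F))) hx.
by rewrite vdotZr unit; lra.
Qed.

End Drawing.

(** * Neighbouring tiles along the cycle *)

Section Cycle.
Variable F : nat.
Hypothesis Feven : ~~ odd F.
Implicit Types (f i : 'I_F) (k : 'I_4).

Lemma ordS_invariant (T : Type) (p : 'I_F -> T) :
  (forall i, p (ordS i) = p i) -> forall i j, p i = p j.
Proof.
move=> hp i j; have F0 : (0 < F)%N by case: i => m; case: (F).
suff h m (lt_mF : (m < F)%N) : p (Ordinal lt_mF) = p (Ordinal F0).
  by case: i j => [i hi] [j hj]; rewrite !h.
elim: m lt_mF => [|m IH] lt_mF; first by congr (p _); apply: val_inj.
rewrite -(IH (ltnW lt_mF)) -(hp (Ordinal (ltnW lt_mF))); congr (p _); apply: val_inj => /=.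
by rewrite modn_small ?lt_mF.
Qed.

Lemma face_n1K : involutive (@face_n1 F).
Proof.
move=> f; rewrite /face_n1; case: (boolP (odd f)) => o.
  by rewrite odd_ord_pred // o ord_predK.
by rewrite odd_ordS // o ordSK.
Qed.

Lemma face_n3K : involutive (@face_n3 F).
Proof.
move=> f; rewrite /face_n3; case: (boolP (odd f)) => o.
  by rewrite odd_ordS // o ordSK.
by rewrite odd_ord_pred // o ord_predK.
Qed.

Lemma odd_face_n1 f : odd (face_n1 f) = ~~ odd f.
Proof. by rewrite /face_n1; case: ifP => o; rewrite ?odd_ord_pred ?odd_ordS ?o. Qed.

Lemma odd_face_n3 f : odd (face_n3 f) = ~~ odd f.
Proof. by rewrite /face_n3; case: ifP => o; rewrite ?odd_ord_pred ?odd_ordS ?o. Qed.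

Lemma neighbor_invariant (T : Type) (p : 'I_F -> T) :
  (forall f, p (face_n1 f) = p f) -> (forall f, p (face_n3 f) = p f) ->
  forall i j, p i = p j.
Proof.
move=> h1 h3; apply: ordS_invariant => i.
by have := h1 i; have := h3 i; rewrite /face_n1 /face_n3; case: ifP.
Qed.

Lemma side1_face_n1 f : side (face_n1 f) 1 = side f 1.
Proof.
rewrite /side /= odd_face_n1 /face_n1.
by case: (boolP (odd f)) => _; rewrite ?ordSK.
Qed.

Lemma side2_face_n3 f : side (face_n3 f) 2 = side f 2.
Proof.
rewrite /side /= odd_face_n3 /face_n3.
by case: (boolP (odd f)) => _; rewrite ?ordSK.
Qed.

(* The neighbour [far_face e f] is the one across the [b]-edge of the tile [f]
   when the [b]-edges are the sides number 1 ([e]) or number 2 ([~~ e]). *)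
Definition far_face (e : bool) f := if e then face_n1 f else face_n3 f.
Definition near_face (e : bool) f := if e then face_n3 f else face_n1 f.

Lemma far_faceK e : involutive (far_face e).
Proof. by case: e; [exact: face_n1K | exact: face_n3K]. Qed.

Lemma near_faceK e : involutive (near_face e).
Proof. by case: e; [exact: face_n3K | exact: face_n1K]. Qed.

Lemma odd_far_face e f : odd (far_face e f) = ~~ odd f.
Proof. by case: e; [exact: odd_face_n1 | exact: odd_face_n3]. Qed.

Lemma odd_near_face e f : odd (near_face e f) = ~~ odd f.
Proof. by case: e; [exact: odd_face_n3 | exact: odd_face_n1]. Qed.

(** This leads from the edge between [f] and [near_face e f] to the next cycle edge of the same
    kind, with the tile centre on the same side. *)
Definition shift_face e f := far_face e (near_face e f).

Lemma shift_faceE e f :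
  shift_face e f = if odd f == e then ordS (ordS f) else ord_pred (ord_pred f).
Proof.
rewrite /shift_face /far_face /near_face /face_n1 /face_n3.
by case: e; case: (boolP (odd f)) => o;
  rewrite ?odd_ordS ?odd_ord_pred // ?o ?(negbTE o).
Qed.

Lemma odd_shift_face e f : odd (shift_face e f) = odd f.
Proof. by rewrite odd_far_face odd_near_face negbK. Qed.

Lemma val_ordS f : nat_of_ord (ordS f) = if (f.+1 < F)%N then f.+1 else 0%N.
Proof.
rewrite /=; case: ltnP => h; first by rewrite modn_small.
have -> : f.+1 = F :> nat by apply/eqP; rewrite eqn_leq h ltn_ord.
by rewrite modnn.
Qed.

Lemma ordS4_neq f : (4 < F)%N -> ordS (ordS (ordS (ordS f))) != f.
Proof.
move=> F4; apply/eqP => /(congr1 (@nat_of_ord F)).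
have := val_ordS f; have := val_ordS (ordS f).
have := val_ordS (ordS (ordS f)); have := val_ordS (ordS (ordS (ordS f))).
by case: ltnP => ? ->; case: ltnP => ? ?; case: ltnP => ? ?; case: ltnP => ? ?; lia.
Qed.

(** A shift keeps the parity, so both shifts go the same way and move four places along the
    cycle. *)
Lemma shift2_face_neq e f : (4 < F)%N -> shift_face e (shift_face e f) != f.
Proof.
move=> F4; rewrite [shift_face e (_ e f)]shift_faceE odd_shift_face shift_faceE.
case: (odd f == e); first exact: ordS4_neq.
apply/eqP => h; have := ordS4_neq f F4.
by rewrite -{1}h !ord_predK eqxx.
Qed.

(** These are the four dihedral labelings without a b-edge on a meridian: [e] places the b-edge on
    side 1 or 2, and [s] puts gamma instead of beta at the pole. *)
Definition lab_form (e s : bool) k : 'I_4 :=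
  if e then if s then 2 + k else 1 - k else if s then 2 - k else 1 + k.

End Cycle.

(** In the sums at [j] and [far j] together, alpha and delta each occur twice whatever the labels.
    As [be] and [ga] differ, the unordered pair of labels at [near j] and [near (far j)] is then the
    same for all [j]; if its two members agree once, [s] is constant. *)
Lemma vertex_sums_dichotomy (R : realType) (I : Type) (near far : I -> I)
    (s : I -> bool) (al be ga de K : R) :
  involutive near -> involutive far -> be != ga ->
  (forall j, (if s j then al else de) + (if s (near j) then be else ga) +
             (if s (far j) then de else al) = K) ->
  (exists s0, forall j, s j = s0) \/
  (forall j, s (far j) = ~~ s j) /\
  ((forall j, s (near j) = s j) \/ (forall j, s (near j) = ~~ s j)).
Proof.
move=> nearK farK /eqP bg sumK.
have pair j : (if s (near j) then be else ga) +
    (if s (near (far j)) then be else ga) = K + K - (al + de) - (al + de).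
  have := sumK j; have := sumK (far j); rewrite farK.
  by case: (s j); case: (s (far j)); lra.
have both_eq j0 s0 : s (near j0) = s0 -> s (near (far j0)) = s0 -> forall j, s j = s0.
  move=> h h' j; have := pair j0; have := pair (near j); rewrite h h' nearK.
  by case: (s j) (s (near (far _))) s0 {h h'} => -[] [] //= h h'; case: bg; lra.
have [[j0 ej0]|noeq] := pselect (exists j, s (far j) = s j).
  left; exists (s (near j0)); apply: both_eq => //; apply/esym.
  have := sumK j0; have := sumK (far j0); rewrite farK ej0.
  by case: (s j0) (s (near j0)) (s (near (far _))) => -[] [] //= h h'; case: bg; lra.
have far_neg j : s (far j) = ~~ s j.
  by case: (s (far j) =P s j) => [h|]; [case: noeq; exists j | case: (s j) (s (far j)) => -[]].
have [[s0 h]|nconst] := pselect (exists s0, forall j, s j = s0); first by left; exists s0.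
right; split=> //.
have near_far j : s (near (far j)) = ~~ s (near j).
  case: (s (near (far j)) =P s (near j)) => [h|].
    by case: nconst; exists (s (near j)); apply: both_eq.
  by case: (s (near j)) (s (near (far j))) => -[].
(* Since [far] flips labels, the sum at [i] is twice [al] or twice [de] plus the near term, so the
   label of [i] determines that of [near i]. *)
have same i j : s i = s j -> s (near i) = s (near j).
  move=> h; have := sumK i; have := sumK j; rewrite !far_neg h.
  by case: (s j) (s (near i)) (s (near j)) => -[] [] //= h1 h2; case: bg; lra.
have [[j0 h]|noeq2] := pselect (exists j, s (near j) = s j).
  left=> j; have [hj|hj] := s j =P s j0; first by rewrite (same j j0) // h hj.
  have {}hj : s j = s (far j0) by move: hj; rewrite far_neg; case: (s j) (s j0) => -[].
  by rewrite (same _ _ hj) near_far h hj far_neg.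
right=> j; case: (s (near j) =P s j) => [h|]; first by case: noeq2; exists j.
by case: (s j) (s (near j)) => -[].
Qed.

Lemma forall_I4 (P : 'I_4 -> Prop) : P 0 -> P 1 -> P 2 -> P 3 -> forall k, P k.
Proof.
move=> P0 P1 P2 P3 [[|[|[|[|//]]]] h].
- by have -> : Ordinal h = 0 by exact: val_inj.
- by have -> : Ordinal h = 1 by exact: val_inj.
- by have -> : Ordinal h = 2 by exact: val_inj.
- by have -> : Ordinal h = 3 by exact: val_inj.
Qed.

(** * From edge lengths to labelings, and from constant labels to the chart *)

Section Chart.
Variables (R : realType) (F t : nat) (D : sph_drawing R F) (a b c : R).
Variables (ang : 'I_4 -> R) (lab : 'I_F -> 'I_4 -> 'I_4).
Hypotheses (Feven : ~~ odd F) (chartD : is_chart D t a b c ang lab).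
Implicit Types (f i : 'I_F) (k : 'I_4).

Lemma quad_type_neq : a != b /\ c != b.
Proof.
case: chartD; rewrite /quad_type; case: eqP => _.
  by case=> ab bc _ _ _ _; split=> //; rewrite eq_sym.
by case: eqP => _ // -[-> ab] _ _ _.
Qed.

(** Neighbours give a shared cycle edge the same side number, 1 or 2, so the position of the b-edge
    propagates around the cycle as a single [e]. *)
Lemma lab_forms (f0 : 'I_F) : (forall i, elen D (inr i) != b) ->
  exists e, exists s, forall f k, lab f k = lab_form e (s f) k.
Proof.
move=> mer; have [ab cb] := quad_type_neq.
case: chartD => _ dih _ lens.
pose b1 f := elen D (side f 1) == b.
have face f : exists s, (elen D (side f 2) == b) = ~~ b1 f /\
    forall k, lab f k = lab_form (b1 f) s k.
  have [r labf] := dih f.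
  have := lens f 0; have := lens f 1; have := lens f 2; have := lens f 3.
  have /eqP := mer (face_n1 f); have /eqP := mer (face_n3 f).
  (* Of the eight dihedral labelings, four put length b on a meridian and contradict [m0] or
     [m3]. *)
  rewrite /b1; case: labf => labf; move: labf; elim/forall_I4: r => labf;
    rewrite !labf {1 2 4}/side /= => m3 m0 l3 l2 l1 l0;
    rewrite l1 l2 /proto_len /=; do ?[by case: m0; rewrite l0 | by case: m3; rewrite l3].
  - by rewrite (negbTE cb) eqxx; exists false.
  - by rewrite (negbTE ab) eqxx; exists true.
  - by rewrite (negbTE cb) eqxx; exists false.
  - by rewrite (negbTE ab) eqxx; exists true.
have b1_const : forall f, b1 f = b1 f0.
  move=> f; apply: (neighbor_invariant (p := b1)) => {}f; first by rewrite /b1 side1_face_n1.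
  have [_ [h _]] := face f; have [_ [h' _]] := face (face_n3 f).
  by move: h'; rewrite side2_face_n3 // h => /negb_inj.
have [s hs] := choice face; exists (b1 f0), s => f k.
by have [_ ->] := hs f; rewrite b1_const.
Qed.

Lemma chart_of_constant_labels (e s0 : bool) : (s0 -> t = 2%N) ->
  (forall f k, lab f k = lab_form e s0 k) ->
  chart_is_PF_mod_mirror D t a b c lab.
Proof.
move=> ht labE; have [_ _ _ lens] := chartD.
have ca : s0 -> c = a.
  by move=> /ht t2; case: chartD; rewrite t2 => -[].
case: e labE => labE.
  (* The map is already in position; the relabeling is applied exactly when gamma is at the
     poles. *)
  exists id, false, s0; split=> // f k; exists f, k.
  split; [by [] | |].
    by rewrite labE; case: s0 {ht labE ca}; elim/forall_I4: k; exact: val_inj.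
  rewrite lens !labE; case: s0 ht labE ca => ht labE ca; [rewrite (ca isT)|];
    elim/forall_I4: k; rewrite /proto_len /side //=;
    by case: (boolP (odd f)) => o; rewrite ?(odd_ord_pred Feven) ?o ?(negbTE o).
(* Moving one step along the cycle and exchanging the poles reverses all cyclic orders; corners are
   then met backwards, whence [- k] below. *)
exists (fun x => match x with inl i => inl (ordS i) | inr p => inr (~~ p) end), true, s0.
split=> //.
  case=> [i|p] [j|q] //; last by case=> /negb_inj ->.
  by move/(congr1 (fun x : pdw_vertex F => if x is inl l then l else i))/ordS_inj ->.
move=> f k; exists (ordS f), (- k); split.
- rewrite /corner_triple; have cornerE j : corner (ordS f) (- j) =
      match corner f j with inl i => inl (ordS i) | inr p => inr (~~ p) end.
    elim/forall_I4: j; rewrite /corner /= /face_pole /face_n1 /face_n3 ?(odd_modn_even Feven) /=;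
    by case: (odd f); rewrite ?ordSK ?ord_predK.
  by rewrite -!cornerE opprB opprD [1 - k]addrC.
- by rewrite labE; case: s0 {ht labE ca}; elim/forall_I4: k; exact: val_inj.
- rewrite lens !labE; case: s0 ht labE ca => ht labE ca; [rewrite (ca isT)|];
    elim/forall_I4: k; rewrite /proto_len /side //= ?(odd_modn_even Feven) /=;
    by case: (boolP (odd f)) => o;
      rewrite ?ordSK ?ord_predK ?(odd_ord_pred Feven) ?(odd_ordS Feven) ?o ?(negbTE o).
Qed.

End Chart.

(** * Angle sums at the cycle vertices and at the poles *)

Section AngleSums.
Variables (R : realType) (F : nat) (D : sph_drawing R F).
Hypotheses (Feven : ~~ odd F) (tilD : is_pdw_tiling D).
Implicit Types (f i : 'I_F) (k : 'I_4).

Lemma corner_sumE (x : pdw_vertex F) :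
  \sum_(k < 4) \sum_(f | corner f k == x) inner_angle D f k = 2 * pi.
Proof.
case: tilD => _ _ _ _ /(_ x) <-.
rewrite [RHS]big_mkcond /= -(pair_bigA _ (fun f k =>
  if corner f k == x then inner_angle D f k else 0)) /= exchange_big /=.
by apply: eq_bigr => k _; rewrite [LHS]big_mkcond.
Qed.

Lemma vertex_angle_sum i :
  inner_angle D i 2 + inner_angle D (face_n1 i) 1 + inner_angle D (face_n3 i) 3 = 2 * pi.
Proof.
rewrite -(corner_sumE (vv i)) !big_ord_recl big_ord0 addr0 /=.
rewrite big_pred0 => [|f]; last by rewrite /corner /= /face_pole; case: ifP.
have -> : lift ord0 ord0 = 1 :> 'I_4 by exact: val_inj.
have -> : lift ord0 (lift ord0 ord0) = 2 :> 'I_4 by exact: val_inj.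
have -> : lift ord0 (lift ord0 (lift ord0 ord0)) = 3 :> 'I_4 by exact: val_inj.
have vvE (j l : 'I_F) : (vv j == vv l) = (j == l) by [].
rewrite add0r addrCA addrA; congr (_ + _ + _); apply/esym/big_pred1 => f;
  rewrite /corner /= vvE //.
  by rewrite (can2_eq (face_n1K Feven) (face_n1K Feven)).
by rewrite (can2_eq (face_n3K Feven) (face_n3K Feven)).
Qed.

Lemma pole_angle_sum (p : bool) :
  \sum_(f : 'I_F | odd f == p) inner_angle D f 0 = 2 * pi.
Proof.
rewrite -(corner_sumE (inr p)) big_ord_recl /= [X in _ + X]big1 ?addr0.
  by apply: eq_bigl => f; rewrite /corner /= /face_pole; case: (odd f); case: p.
move=> k _; apply: big_pred0 => f; rewrite /corner.
by case: k => [[|[|[|//]]]].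
Qed.

Lemma pole_angle_total : \sum_(f < F) inner_angle D f 0 = 4 * pi.
Proof.
rewrite (bigID (fun f : 'I_F => odd f == true)) /= pole_angle_sum.
rewrite (eq_bigl (fun f : 'I_F => odd f == false)) ?pole_angle_sum; first by lra.
by move=> f; case: odd.
Qed.

End AngleSums.

Lemma eq_cos_sum (R : realType) (x y : R) : 0 <= x <= 2 * pi -> 0 <= y <= 2 * pi ->
  x != y -> cos x = cos y -> x + y = 2 * pi.
Proof.
have reflect (z : R) : cos (2 * pi - z) = cos z.
  have -> : 2 * pi - z = - z + pi *+ 2 by ring.
  by rewrite cosD2pi cosN.
move=> /andP[x0 x2] /andP[y0 y2] /eqP xy.
have [xpi|xpi] := leP x pi; have [ypi|ypi] := leP y pi => cosE.
- by case: xy; apply: cos_inj => //; rewrite in_itv /= ?x0 ?y0.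
- have : x = 2 * pi - y; last by lra.
  by apply: cos_inj; rewrite ?in_itv /= ?x0 ?reflect //; apply/andP; split; lra.
- have : y = 2 * pi - x; last by lra.
  by apply: cos_inj; rewrite ?in_itv /= ?y0 ?reflect //; apply/andP; split; lra.
- case: xy; have : 2 * pi - x = 2 * pi - y; last by lra.
  by apply: cos_inj; rewrite ?in_itv /= ?reflect //; apply/andP; split; lra.
Qed.

(** * Type 2: geometry of a tile with three sides of length a *)

Section TypeTwo.
Variables (R : realType) (F : nat) (D : sph_drawing R F) (a b c : R).
Variables (ang : 'I_4 -> R) (lab : 'I_F -> 'I_4 -> 'I_4).
Variables (e : bool) (s : 'I_F -> bool).
Hypotheses (F6 : (6 <= F)%N) (Feven : ~~ odd F) (tilD : is_pdw_tiling D).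
Hypotheses (chartD : is_chart D 2 a b c ang lab).
Hypothesis labE : forall f k, lab f k = lab_form e (s f) k.
Implicit Types (f i : 'I_F) (k : 'I_4).

Notation V i := (pos D (vv i)).
Notation P f := (pos D (face_pole f)).
Notation near := (near_face e).
Notation far := (far_face e).
Notation shift := (shift_face e).
Notation be := (ang 1).
Notation ga := (ang 2).

(* [X false] is the angle at the pole of a tile with [s f = false]; the angle
   at the near vertex of the tile [f] is [X (~~ s f)]. *)
Definition pole_ang (x : bool) := if x then ga else be.
Notation X := pole_ang.

Lemma type2_ca : c = a. Proof. by case: chartD => -[]. Qed.
Lemma type2_ab : a <> b. Proof. by case: chartD => -[_ /eqP]. Qed.

Lemma elen_side f k :
  elen D (side f k) = if k == (if e then 1 else 2) then b else a.
Proof.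
case: chartD => _ _ _ ->; rewrite !labE type2_ca.
by case: e (s f) => -[]; elim/forall_I4: k.
Qed.

Lemma elen_meridian i : elen D (inr i) = a.
Proof.
have := elen_side (face_n1 i) 0; rewrite /side /= face_n1K //.
by case: e.
Qed.

Lemma a_lt_pi : a < pi.
Proof.
apply: (meridian_lt_pi tilD) elen_meridian.
exact: leq_trans F6.
Qed.

Lemma pole_angleE f : inner_angle D f 0 = X (s f).
Proof.
case: chartD => _ _ -> _; rewrite labE /X.
by case: e (s f) => -[]; congr (ang _); exact: val_inj.
Qed.

Lemma near_angleE f : inner_angle D f (if e then 3 else 1) = X (~~ s f).
Proof.
case: chartD => _ _ -> _; rewrite labE /X.
by case: e (s f) => -[]; congr (ang _); exact: val_inj.
Qed.

Lemma vertex_sum j : (if s j then ang 0 else ang 3) + (if s (near j) then be else ga) +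
   (if s (far j) then ang 3 else ang 0) = 2 * pi.
Proof.
rewrite -(vertex_angle_sum Feven tilD j).
case: chartD => _ _ angE _; rewrite !angE !labE /far_face /near_face.
case: e; [rewrite [RHS]addrAC|]; congr (_ + _ + _);
  by case: (s _); congr (ang _); exact: val_inj.
Qed.

(** Inner angles turn counterclockwise, but [e] decides on which hand of a tile its near vertex
    lies; this sign gives both cases the same rotation formulas. *)
Definition orient (phi : R) := if e then - phi else phi.

Lemma far_swing f : V (far f) = swing (cos a) (orient (X (s f))) (P f) (V (near f)).
Proof.
have [||] := @corner_swing _ _ D Feven tilD f 0 (cos a).
- by rewrite elen_side; case: e.
- by rewrite !elen_side; case: e.
rewrite pole_angleE /orient /far_face /near_face.
by case: e.
Qed.

Lemma near_swing f :
  P f = swing (cos a) (orient (X (~~ s f))) (V (near f)) (V f) /\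
  V f = swing (cos a) (- orient (X (~~ s f))) (V (near f)) (P f).
Proof.
have [||] := @corner_swing _ _ D Feven tilD f (if e then 3 else 1) (cos a).
- by rewrite elen_side; case: e.
- by rewrite !elen_side; case: e.
rewrite near_angleE /orient /far_face /near_face.
by case: e => h1 h2; split=> //; rewrite opprK.
Qed.

Lemma cos_orient phi : cos (orient phi) = cos phi.
Proof. by rewrite /orient; case: e; rewrite ?cosN. Qed.

(* The two meridians ending at [v_f] and [v_(near f)] lie on opposite sides of
   the edge between these points and make the same angle with it, so a half-turn
   about the midpoint of the edge exchanges the two poles. *)
Lemma pole_sum f phi : X (~~ s f) = phi -> X (~~ s (near f)) = phi ->
  vadd (P f) (P (near f)) =
  vscale (cos a + (1 - cos a) * cos phi) (vadd (V f) (V (near f))).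
Proof.
move=> sf sn; have [-> _] := near_swing f; have [+ _] := near_swing (near f).
rewrite sf sn near_faceK // => ->; rewrite /swing cos_orient.
by apply: vec3P => /=; ring.
Qed.

Lemma near_neq_far f : near f <> far f.
Proof.
move=> h; have := @shift2_face_neq F Feven e f (ltnW F6).
by rewrite /shift_face h !far_faceK // h far_faceK // eqxx.
Qed.

Lemma odd_neq f (g : 'I_F) : odd f != odd g -> vv f != vv g.
Proof. by apply: contra_neq => -[->]. Qed.

Lemma near_edge_joins f : joins (side f (if e then 2 else 1)) (vv f) (vv (near f)).
Proof.
have := @side_joins F Feven f 2; have := @side_joins F Feven f 1.
by rewrite /near_face; case: e => // ? ?; apply: joinsC.
Qed.

Lemma face_pole_parity f (g : 'I_F) : odd f = odd g -> face_pole f = face_pole g.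
Proof. by rewrite /face_pole => ->. Qed.

(** The two edges belong to the same pair of poles and get the same factor in [pole_sum]. If it were
    nonzero, their endpoint sums would agree and the edges would cross at their midpoints. *)
Lemma near_angle_cos f phi : X (~~ s f) = phi -> X (~~ s (near f)) = phi ->
  X (~~ s (shift (shift f))) = phi -> X (~~ s (near (shift (shift f)))) = phi ->
  cos a + (1 - cos a) * cos phi = 0.
Proof.
set g := shift (shift f); move=> sf snf sg sng.
have oddg : odd g = odd f by rewrite !odd_shift_face.
have neq_gf : g != f by apply: shift2_face_neq => //; exact: ltnW.
have := pole_sum sf snf; have := pole_sum sg sng.
rewrite (face_pole_parity oddg) (@face_pole_parity (near g) (near f)) ?odd_near_face ?oddg //.
move=> ->; set l := (_ + _ * _) => /pair_equal_spec[/pair_equal_spec[h1 h2] h3].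
apply: contrapT => /eqP l0; have {h1 h2 h3} hV : vadd (V g) (V (near g)) = vadd (V f) (V (near f)).
  by apply: vec3P; apply: (mulfI l0).
have len x : elen D (side x (if e then 2 else 1)) < pi.
  by rewrite elen_side (_ : _ == _ = false) ?a_lt_pi //; case: e.
apply: (@edges_disjoint _ _ D tilD _ _ _ _ _ _ 1 1 1 1
  (near_edge_joins g) (near_edge_joins f) (len g) (len f)) => //.
- by apply: odd_neq; rewrite odd_near_face // oddg; case: odd.
- by apply: odd_neq; rewrite odd_near_face // oddg; case: odd.
- by have : near g != near f by rewrite inj_eq //; exact/inv_inj/near_faceK.
- by apply: vec3P => /=; rewrite !mul1r; move: hV => [].
Qed.


(** * Type 2 with beta equal to gamma: trapezoids and the cube *)

Section EqualAngles.
Hypothesis be_ga : be = ga.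

Let XE x : X x = be. Proof. by case: x; rewrite /X // be_ga. Qed.

Lemma equal_angle_cos f : cos a + (1 - cos a) * cos be = 0.
Proof. by apply: (near_angle_cos (f := f)); rewrite XE. Qed.

(** The tile is an isosceles trapezoid over the chord from pole to near vertex: its legs arise by
    opposite turns through the same angle. By [equal_angle_cos] the ratio of the parallel chords is
    [- 2 * cos be]. *)
Lemma b_edge_parallel f :
  vadd (V f) (vscale (2 * cos be) (V (near f))) =
  vadd (V (far f)) (vscale (2 * cos be) (P f)).
Proof.
have C := equal_angle_cos f; have [_ ->] := near_swing f.
rewrite far_swing !XE /swing !(cosN, sinN, cos_orient).
set k := cos be in C *; set C0 := cos a in C *.
have C_mul x : (C0 + (1 - C0) * k) * x = 0 by rewrite C mul0r.
apply: vec3P; apply/subr0_eq.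
- by rewrite -[RHS](C_mul ((V (near f)).1.1 - (P f).1.1)) /=; ring.
- by rewrite -[RHS](C_mul ((V (near f)).1.2 - (P f).1.2)) /=; ring.
- by rewrite -[RHS](C_mul ((V (near f)).2 - (P f).2)) /=; ring.
Qed.

(** With a nonnegative cosine, [b_edge_parallel] would be a crossing of the two legs, which share no
    vertex. *)
Lemma equal_angle_lt0 f : cos be < 0.
Proof.
rewrite ltNge; apply/negP => k0.
have len_side : elen D (side f (if e then 2 else 1)) < pi.
  by rewrite elen_side (_ : _ == _ = false) ?a_lt_pi //; case: e.
have len_mer : elen D (inr (far f)) < pi by rewrite elen_meridian a_lt_pi.
have jm : joins (inr (far f)) (vv (far f)) (face_pole f).
  by left; split=> //=; rewrite /pole_of /face_pole odd_far_face //; case: odd.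
have k2 : 0 <= 2 * cos be by rewrite mulr_ge0.
have k3 : 0 < 1 + 2 * cos be by lra.
apply: (@edges_disjoint _ _ D tilD _ _ _ _ _ _ 1 (2 * cos be) 1 (2 * cos be)
  (near_edge_joins f) jm len_side len_mer) => //.
- by apply: odd_neq; rewrite odd_far_face //; case: odd.
- by rewrite /face_pole; case: odd.
- by have : near f != far f by apply/eqP/near_neq_far.
- by rewrite /face_pole; case: odd.
have h (x : vec3 R) : vscale 1 x = x by apply: vec3P => /=; rewrite mul1r.
by rewrite !h; exact: b_edge_parallel.
Qed.

Lemma equal_angle_total : be * F%:R = 4 * pi.
Proof.
rewrite -(pole_angle_total tilD) (eq_bigr (fun=> be)) => [|f _].
  by rewrite sumr_const card_ord mulr_natr.
by rewrite pole_angleE XE.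
Qed.

(** From [F] = 8 on, the angle 4 pi / F is at most pi / 2 and its cosine is nonnegative. *)
Lemma equal_angle_F f : F = 6%N.
Proof.
apply/eqP; rewrite eqn_leq F6 andbT leqNgt; apply/negP => F7.
have F8 : (8 <= F)%N by move: F7 Feven; rewrite leq_eqVlt => /orP[/eqP <-|].
have {}F8 : 8 <= F%:R :> R by rewrite ler_nat.
have p0 := @pi_gt0 R; have tot := equal_angle_total.
have be0 : 0 < be.
  by rewrite ltNge; apply/negP => be0; have : be * F%:R <= 0; [rewrite mulr_le0_ge0 | lra].
have : be * 8 <= be * F%:R by rewrite ler_pM2l.
have := equal_angle_lt0 f; rewrite ltNge => /negP + be8; apply.
by apply: cos_ge0_pihalf; apply/andP; split; lra.
Qed.

Lemma equal_angle_values f : cos be = - 2^-1 /\ cos a = 3^-1.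
Proof.
have tot := equal_angle_total; rewrite (equal_angle_F f) in tot.
have C := equal_angle_cos f.
(* The angle is 2 pi / 3, whose double has the same cosine; the other root 1 of this equation
   contradicts [C]. *)
have k2 : cos be = 2 * cos be ^+ 2 - 1.
  have : cos (be + be) = cos be.
    have -> : be + be = - be + pi *+ 2 by lra.
    by rewrite cosD2pi cosN.
  by rewrite cosD -!expr2 sin2cos2; lra.
have k1 : cos be != 1 by apply/eqP => k1; rewrite k1 in C; lra.
have k : cos be = - 2^-1.
  have : (cos be - 1) * (cos be + 2^-1) = 0.
    transitivity (2^-1 * (2 * cos be ^+ 2 - 1 - cos be)); first by field.
    by rewrite -k2 subrr mulr0.
  by move/eqP; rewrite mulf_eq0 subr_eq0 (negbTE k1) => /eqP; lra.
by split=> //; rewrite k in C; lra.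
Qed.

Lemma cube_face f : vadd (V f) (P f) = vadd (V (near f)) (V (far f)).
Proof.
have := b_edge_parallel f; have [-> _] := equal_angle_values f.
by case/pair_equal_spec => /pair_equal_spec[h1 h2] h3; apply: vec3P;
  move: h1 h2 h3 => /=; lra.
Qed.

Lemma opposite_poles f : vadd (P f) (P (near f)) = (0, 0, 0).
Proof.
have C := equal_angle_cos f.
by rewrite (pole_sum (phi := be)) ?XE // C; apply: vec3P => /=; rewrite mul0r.
Qed.

(** Add the parallelogram relations of the tiles [near f] and [shift f]: the shared vertices cancel,
    and so do the poles, being opposite. *)
Lemma opposite_vertex f : V (near (shift f)) = vscale (-1) (V f).
Proof.
have := cube_face f; have := cube_face (near f); have := cube_face (shift f).
have := opposite_poles f.
rewrite near_faceK // -/(shift f) {3}/shift_face far_faceK //.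
rewrite (@face_pole_parity (shift f) f) ?odd_shift_face //.
move=> /pair_equal_spec[/pair_equal_spec[p1 p2] p3].
move=> /pair_equal_spec[/pair_equal_spec[a1 a2] a3].
move=> /pair_equal_spec[/pair_equal_spec[b1 b2] b3] _.
by apply: vec3P => /=; lra.
Qed.

(* The [b]-edge has the same cosine as [a], so it is the complementary long arc,
   which runs through the vertex opposite to its origin. *)
Lemma equal_angles_absurd (f0 : 'I_F) : False.
Proof.
pose kb : 'I_4 := if e then 1 else 2.
have jb f : joins (side f kb) (vv f) (vv (far f)).
  have := @side_joins F Feven f 2; have := @side_joins F Feven f 1.
  by rewrite /kb /far_face; case: e => // ? ?; apply: joinsC.
(* Parameter pi on an edge is the antipode of its source, so a tile is chosen whose centre is the
   source of its b-edge. *)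
have [f [fb fsrc]] : exists f, esrc (side f kb) = vv f /\ incident (vv f) (side f kb).
  have [[hs hd]|[hs hd]] := jb f0.
    by exists f0; split=> //; rewrite /incident hs eqxx.
  exists (far f0).
  have -> : side (far f0) kb = side f0 kb.
    by rewrite /kb /far_face; case: e; [rewrite side1_face_n1|rewrite side2_face_n3].
  by rewrite hs /incident hs eqxx.
have [kbe cosa] := equal_angle_values f.
case: (tilD) => unit _ edges _ _.
have lenb : elen D (side f kb) = b by rewrite elen_side eqxx.
have [_ _ /andP[b0 b2] _] := edges (side f kb).
have [_ _ /andP[a0 a2] _] := edges (inr f).
rewrite elen_meridian in a0 a2; rewrite lenb in b0 b2.
have unit_dot (x y z w : vec3 R) : vadd x y = vadd z w -> vdot x w = vdot x x + vdot x y - vdot x z.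
  move=> h; have := congr1 (vdot x) h; rewrite !vdotDr; lra.
have dot_b : vdot (V f) (V (far f)) = cos b.
  have [_ tu ->] := dart_end Feven tilD (jb f).
  by rewrite vdotDr !vdotZr unit [vdot (V f) _]vdotC tu lenb; ring.
have dot_a : vdot (V f) (V (near f)) = cos a.
  have [_ tu ->] := dart_end Feven tilD (near_edge_joins f).
  rewrite vdotDr !vdotZr unit [vdot (V f) _]vdotC tu elen_side.
  by rewrite (_ : _ == _ = false); [ring | case: e].
have dot_P : vdot (V f) (P f) = cos a * cos a + cos be * (1 - cos a * cos a).
  have [_ ->] := near_swing f; rewrite XE.
  have jn : joins (inr (near f)) (vv (near f)) (face_pole f).
    by left; split=> //=; rewrite /pole_of /face_pole odd_near_face //; case: odd.
  have nP : vdot (V (near f)) (P f) = cos a.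
    have [_ tu ->] := dart_end Feven tilD jn.
    by rewrite vdotDr !vdotZr unit [vdot (V _) _]vdotC tu elen_meridian; ring.
  have -> (C phi : R) (x y : vec3 R) : vdot (swing C phi x y) y =
      C * vdot x y + cos phi * (vdot y y - C * vdot x y).
    by rewrite /swing /vdot /=; ring.
  by rewrite nP unit cosN cos_orient; ring.
have cosb : cos b = cos a.
  by rewrite -dot_b (unit_dot _ _ _ _ (cube_face f)) unit dot_a dot_P kbe cosa; lra.
have ba : b = 2 * pi - a.
  have : a + b = 2 * pi; last by lra.
  apply: eq_cos_sum => //; last by apply/eqP/type2_ab.
    by rewrite !ltW.
  by rewrite !ltW.
have pi_b : (0 : R) <= pi <= elen D (side f kb).
  apply/andP; split; first exact: pi_ge0.
  by rewrite lenb ba; have := a_lt_pi; lra.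
have : incident (vv (near (shift f))) (side f kb).
  apply: (vertex_on_edge tilD pi_b); rewrite /Defs.arc fb cospi sinpi opposite_vertex.
  by apply: vec3P => /=; rewrite mul0r addr0.
(* The antipode is neither end of the b-edge: parity excludes [f], and [far f] would make two shifts
   the identity. *)
move=> /(incident_joins (jb f))[] hv.
  have := @odd_neq (near (shift f)) f; rewrite hv eqxx.
  by rewrite odd_near_face // odd_shift_face //; case: odd => /(_ isT).
have {}hv : near (shift f) = far f.
  by have := congr1 (fun x : pdw_vertex F => if x is inl l then l else f) hv.
have := @shift2_face_neq F Feven e f (ltnW F6).
by rewrite [shift (shift f)]/shift_face hv far_faceK // eqxx.
Qed.

End EqualAngles.

(** * Type 2: excluding the alternating labelings *)

Lemma labels_constant : exists s0, forall f, s f = s0.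
Proof.
have F0 : (0 < F)%N by exact: leq_trans F6.
pose f0 : 'I_F := Ordinal F0.
have bg : be != ga by apply/eqP => be_ga; exact: equal_angles_absurd be_ga f0.
case: (vertex_sums_dichotomy (near_faceK Feven e) (far_faceK Feven e) bg vertex_sum) => //.
case=> sfar [] snear.
(* One shift flips the label, so the second shift is what brings back an edge with the same
   angle. *)
- have sshift f : s (shift (shift f)) = s f by rewrite /shift_face !(sfar, snear) negbK.
  have CX x : cos a + (1 - cos a) * cos (X x) = 0.
    have [f sf] : exists f, s f = ~~ x.
      case: (s f0 =P ~~ x) => [|h]; first by exists f0.
      by exists (far f0); rewrite sfar; case: (s f0) x h => -[].
    by apply: (near_angle_cos (f := f)); rewrite ?snear ?sshift ?snear sf negbK.
  have a1 : 1 - cos a != 0.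
    by apply/eqP => a1; have := CX true; rewrite a1; lra.
  have cosE : cos be = cos ga.
    by apply: (mulfI a1); have := CX true; have := CX false; rewrite /X; lra.
  have angle_itv x : 0 <= X x <= 2 * pi.
    case: (s f0 =P x) => [<-|h]; first by rewrite -pole_angleE; exact: inner_angle_itv.
    have <- : s (far f0) = x by rewrite sfar; case: (s f0) x h => -[].
    by rewrite -pole_angleE; exact: inner_angle_itv.
  have sum_bg : be + ga = 2 * pi := eq_cos_sum (angle_itv false) (angle_itv true) bg cosE.
  have tot := pole_angle_total tilD.
  have tot' : \sum_(f < F) inner_angle D (far f) 0 = 4 * pi.
    by rewrite -tot [RHS](reindex_inj (inv_inj (far_faceK Feven e))).
  (* Summing the pole angles over [f] and over [far f] pairs one beta with one gamma for every
     tile. *)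
  have : (be + ga) * F%:R = 8 * pi.
    have -> : 8 * pi = 4 * pi + 4 * pi :> R by ring.
    rewrite -{1}tot -tot' -big_split /= (eq_bigr (fun=> be + ga)) => [|f _].
      by rewrite sumr_const card_ord mulr_natr.
    by rewrite !pole_angleE sfar /X; case: (s f) => /=; rewrite // addrC.
  have F6R : 6 <= F%:R :> R by rewrite ler_nat.
  have : pi * 6 <= pi * F%:R :> R by rewrite ler_pM2l ?pi_gt0.
  by have := @pi_gt0 R; rewrite sum_bg => p0 h1 h2; exfalso; lra.
- have s_n1 f : s (face_n1 f) = ~~ s f.
    by have := sfar f; have := snear f; rewrite /near_face /far_face; case: e.
  have s_n3 f : s (face_n3 f) = ~~ s f.
    by have := sfar f; have := snear f; rewrite /near_face /far_face; case: e.
  have sE f : s f = s f0 (+) odd f.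
    have /= : s f (+) odd f = s f0 (+) odd f0.
      apply: (neighbor_invariant (p := fun f => s f (+) odd f)) => {}f.
        by rewrite s_n1 odd_face_n1 // addNb addbN negbK.
      by rewrite s_n3 odd_face_n3 // addNb addbN negbK.
    by rewrite addbF => <-; rewrite -addbA addbb addbF.
  (* Labels follow parity here, so one pole has only beta around it and the other only gamma, with
     equally many tiles. *)
  have := pole_angle_sum tilD true; rewrite (eq_bigr (fun=> X (~~ s f0))) => [|f /eqP fo].
    rewrite sumr_const => sum_odd.
    have := pole_angle_sum tilD false.
    rewrite (reindex_inj (inv_inj (near_faceK Feven e))) /=.
    rewrite (eq_big (fun f : 'I_F => odd f == true) (fun=> X (s f0))) => [||f].
    + rewrite sumr_const -sum_odd => /eqP; rewrite -subr_eq0 -mulrnBl mulrn_eq0.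
      case/orP => [/eqP n0|].
        by move: sum_odd; rewrite n0 mulr0n; have := @pi_gt0 R; lra.
      rewrite subr_eq0 => /eqP XX; case/eqP: bg.
      by move: XX; rewrite /X; case: (s f0).
    + by move=> f; rewrite odd_near_face //; case: odd.
    + by rewrite odd_near_face // pole_angleE sE odd_near_face // => /eqP ->; rewrite addbF.
  by rewrite pole_angleE sE fo addbT.
Qed.

End TypeTwo.

(** * Assembly, with the case of type 4 *)

Theorem theorem5 (R : realType) (F : nat) (t : nat)
    (D : sph_drawing R F) (a b c : R) (ang : 'I_4 -> R)
    (lab : 'I_F -> 'I_4 -> 'I_4) :
  (6 <= F)%N -> ~~ odd F -> (t = 2%N \/ t = 4%N) ->
  is_pdw_tiling D ->
  is_chart D t a b c ang lab ->
  (* every edge of length b is non-meridian *)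
  (forall i : 'I_F, elen D (inr i) != b) ->
  chart_is_PF_mod_mirror D t a b c lab.
Proof.
move=> F6 Feven t24 tilD chartD mer.
have f0 : 'I_F by exists 0%N; exact: leq_trans F6.
have [e [s labE]] := lab_forms Feven chartD f0 mer.
suff [s0 [sE ht]] : exists s0 : bool, (forall f, s f = s0) /\ (s0 -> t = 2%N).
  by apply: (chart_of_constant_labels Feven chartD ht) => f k; rewrite labE sE.
case: t24 chartD => ->; first by move=> chartD; have [s0 sE] :=
  labels_constant F6 Feven tilD chartD labE; exists s0.
move=> [[_ _ /eqP ac] _ _ lens].
(* With gamma at the pole, the far meridian of the tile has length c. For the tile across it this is
   the near meridian, of length a under either label. *)
suff sF f : s f = false by exists false.
apply/negP => sf; apply: ac.
have : elen D (inr (far_face e f)) = c.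
  have := lens f (if e then 0 else 3); rewrite !labE sf.
  by rewrite /far_face; case: (e).
have := lens (near_face e (far_face e f)) (if e then 3 else 0).
rewrite !labE.
have -> : side (near_face e (far_face e f)) (if e then 3 else 0) = inr (far_face e f).
  by case: (e); rewrite /side /= ?face_n3K ?face_n1K.
by move=> -> <-; case: (e) (s _) => -[].
Qed.
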